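(* Let $n\ge 1$ and let $F\in M_n(\mathbb C)$ be the Fourier matrix, $F_{ij}=w^{ij}$ for $i,j\in\{1,\ldots,n\}$, where $w=e^{2\pi i/n}$ (in the exponent of $e$, $i$ is the imaginary unit). Then the quantum permutation algebra $A(F)$ associated to $F$ satisfies $A(F)=C(\mathbb Z_n)$, where $C(\mathbb Z_n)$ is the algebra of complex functions on the cyclic group $\mathbb Z_n$.
   Context: A projection in a (unital) $C^*$-algebra is an element $p$ with $p^2=p=p^*$; projections $p,q$ are orthogonal if $pq=0$; a partition of unity is a set of pairwise orthogonal projections summing to $1$. A magic unitary is a square matrix $u\in M_n(A)$ over a $C^*$-algebra $A$, all of whose rows and columns are partitions of unity in $A$. $A(S_n)$ is the universal $C^*$-algebra generated by $n^2$ elements $x_{ij}$ with the relations making $(x_{ij})$ a magic unitary; it carries the morphisms $\Delta(x_{ij})=\sum_k x_{ik}\otimes x_{kj}$, $\varepsilon(x_{ij})=\delta_{ij}$, $S(x_{ij})=x_{ji}$. A quantum permutation algebra is a $C^*$-algebra $A$ given with a magic unitary $u\in M_n(A)$ whose entries generate $A$ and such that $\Delta(u_{ij})=\sum_k u_{ik}\otimes u_{kj}$, $\varepsilon(u_{ij})=\delta_{ij}$, $S(u_{ij})=u_{ji}$ define morphisms of $C^*$-algebras $A\to A\otimes A$, $A\to\mathbb C$, $A\to A^{op}$. For a finite group $G\subset S_n$, $C(G)$ is a quantum permutation algebra with magic unitary entries the characteristic functions $\chi_{ij}$ of $\{\sigma\in G\mid\sigma(j)=i\}$. Here $\mathbb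 Z_n$ is regarded as a subgroup of $S_n$ generated by the cycle $c(i)=i-1$ (mod $n$). For a representation $\pi:A(S_n)\to B(H)$, $A_\pi$ denotes the smallest quantum permutation algebra realizing a factorization of $\pi$: there is a factorization $A(S_n)\to A_\pi\to B(H)$ of $\pi$ with first map $x_{ij}\mapsto u_{ij}$, and for every quantum permutation algebra $(A',u')$ with a factorization $A(S_n)\to A'\to B(H)$ of $\pi$, $x_{ij}\mapsto u'_{ij}$, there is a surjective morphism $A'\to A_\pi$ with $u'_{ij}\mapsto u_{ij}$. It exists and is unique up to isomorphism. A (complex) Hadamard matrix is $h\in M_n(\mathbb C)$ with all entries of modulus $1$ and with pairwise orthogonal rows. Let $h_1,\ldots,h_n$ be its rows, viewed as invertible elements of the algebra $\mathbb C^n$ with entrywise product. The rank one orthogonal projections $P_{ij}$ onto the lines $\mathbb C\,(h_j/h_i)$ form a magic unitary over $M_n(\mathbb C)$; let $\pi_h:A(S_n)\to M_n(\mathbb C)$ be the representation $x_{ij}\mapsto P_{ij}$. Then $A(h):=A_{\pi_h}$. *)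

(* Defs.v *)
From HB Require Import structures.
From mathcomp Require Import all_boot all_order all_algebra all_fingroup.
From mathcomp Require Import complex.
From mathcomp Require Import all_classical all_reals all_analysis.
Set Implicit Arguments.
Unset Strict Implicit.
Unset Printing Implicit Defensive.
Import Order.TTheory GRing.Theory Num.Theory.
Import numFieldNormedType.Exports.
Local Open Scope classical_set_scope.
Local Open Scope ring_scope.

(* Algebras are unital and satisfy [1 != 0], as everywhere in MathComp; the
   complex field is [R[i]] for [R : realType], and [x^*] is its conjugation. *)

HB.mixin Record isStarAlgebra (R : realType) A of GRing.Algebra R[i] A := {
  star : A -> A;
  starK : involutive star;
  starD : {morph star : x y / x + y};
  starZ : forall (c : R[i]) x, star (c *: x) = c^* *: star x;
  starM : forall x y, star (x * y) = star y * star x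
}.

#[short(type="starAlgType")]
HB.structure Definition StarAlgebra (R : realType) :=
  {A of GRing.Algebra R[i] A & isStarAlgebra R A}.

(* The norm takes its values in [R[i]], as for the normed modules of the
   library over [R[i]]; it is nonnegative, hence real. *)
HB.mixin Record isPreCStarAlgebra (R : realType) A of StarAlgebra R A := {
  cnorm : A -> R[i];
  cnormD : forall x y, cnorm (x + y) <= cnorm x + cnorm y;
  cnormZ : forall (c : R[i]) x, cnorm (c *: x) = `|c| * cnorm x;
  cnorm_eq0 : forall x, cnorm x = 0 -> x = 0;
  cnormM : forall x y, cnorm (x * y) <= cnorm x * cnorm y;
  cnorm_star : forall x, cnorm (star x * x) = cnorm x ^+ 2
}.

#[short(type="preCStarType")]
HB.structure Definition PreCStarAlgebra (R : realType) :=
  {A of StarAlgebra R A & isPreCStarAlgebra R A}.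

(* A structure inheriting both from rings and from normed modules over another
   ring is rejected by the hierarchy: the normed module underlying [A] is an
   alias [normed A] of [A], on which the topology lives. *)
Definition normed (R : realType) (A : preCStarType R) : Type := A.

HB.instance Definition _ (R : realType) (A : preCStarType R) :=
  GRing.Lmodule.copy (normed A) A.
HB.instance Definition _ (R : realType) (A : preCStarType R) :=
  Lmodule_isNormed.Build R[i] (normed A)
    (@cnormD R A) (@cnormZ R A) (@cnorm_eq0 R A).

HB.mixin Record PreCStarAlgebra_isComplete (R : realType) A
    of PreCStarAlgebra R A := {
  cstar_complete : forall F : set_system (normed A),
    ProperFilter F -> cauchy F -> cvg F
}.

#[short(type="cstarType")]
HB.structure Definition CStarAlgebra (R : realType) :=
  {A of PreCStarAlgebra R A & PreCStarAlgebra_isComplete R A}.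

HB.instance Definition _ (R : realType) (A : cstarType R) :=
  Uniform_isComplete.Build (normed A) (@cstar_complete R A).

(* Morphisms of C*-algebras are the unital *-homomorphisms: they are
   automatically contractive.  Only the *-algebra structures matter, so that
   [R[i]], [A^c] and [M_n] below are only given these. *)
Definition star_morphism (R : realType) (A B : starAlgType R) (f : A -> B) :=
  [/\ linear f, monoid_morphism f & {morph f : x / star x}].

Section ComplexStar.
Variable R : realType.
Local Notation C := (R[i]^o : Type).

Fact complex_starK : involutive (fun x : C => (x : R[i])^*).
Proof. exact: conjCK. Qed.
Fact complex_starD : {morph (fun x : C => (x : R[i])^* : C) : x y / x + y}.
Proof. by move=> x y; rewrite rmorphD. Qed.
Fact complex_starZ (c : R[i]) (x : C) :
  ((c *: x : C) : R[i])^* = c^* *: ((x : R[i])^* : C).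
Proof. exact: rmorphM. Qed.
Fact complex_starM (x y : C) :
  ((x * y : C) : R[i])^* = ((y : R[i])^* * (x : R[i])^*).
Proof. by rewrite rmorphM mulrC. Qed.

HB.instance Definition _ := isStarAlgebra.Build R R[i]^o
  complex_starK complex_starD complex_starZ complex_starM.
End ComplexStar.

Section OppositeStar.
Variables (R : realType).

HB.instance Definition _ (A : algType R[i]) :=
  GRing.Zmodule_isLmodule.Build R[i] A^c
    (@scalerA _ A) (@scale1r _ A) (@scalerDr _ A)
    (fun v a b => @scalerDl _ A v a b).

Fact opp_scalerAl (A : algType R[i]) (c : R[i]) (x y : A^c) :
  c *: (x * y) = (c *: x) * y.
Proof. exact: (@scalerAr _ A c y x). Qed.

HB.instance Definition _ (A : algType R[i]) :=
  GRing.Lmodule_isLalgebra.Build R[i] A^c (@opp_scalerAl A).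

Fact opp_scalerAr (A : algType R[i]) (c : R[i]) (x y : A^c) :
  c *: (x * y) = x * (c *: y).
Proof. exact: (@scalerAl _ A c y x). Qed.

HB.instance Definition _ (A : algType R[i]) :=
  GRing.Lalgebra_isAlgebra.Build R[i] A^c (@opp_scalerAr A).

Fact opp_starM (A : starAlgType R) (x y : A^c) :
  @star R A (x * y) = (@star R A y : A^c) * @star R A x.
Proof. exact: (@starM R A y x). Qed.

HB.instance Definition _ (A : starAlgType R) :=
  isStarAlgebra.Build R A^c (@starK R A) (@starD R A) (@starZ R A)
    (@opp_starM A).
End OppositeStar.

Section MatrixStar.
Variables (R : realType).

Definition adjmx m n (A : 'M[R[i]]_(m, n)) : 'M[R[i]]_(n, m) :=
  (map_mx Num.conj A)^T.

Fact adjmxK m n : cancel (@adjmx m n) (@adjmx n m).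
Proof. by move=> A; apply/matrixP=> i j; rewrite !mxE conjCK. Qed.

Fact adjmxD m n : {morph @adjmx m n : A B / A + B}.
Proof. by move=> A B; apply/matrixP=> i j; rewrite !mxE rmorphD. Qed.

Fact adjmxZ m n (c : R[i]) (A : 'M[R[i]]_(m, n)) :
  adjmx (c *: A) = c^* *: adjmx A.
Proof. by apply/matrixP=> i j; rewrite !mxE rmorphM. Qed.

Fact adjmxM m n p (A : 'M[R[i]]_(m, n)) (B : 'M[R[i]]_(n, p)) :
  adjmx (A *m B) = adjmx B *m adjmx A.
Proof. by rewrite /adjmx map_mxM trmx_mul. Qed.

HB.instance Definition _ n := isStarAlgebra.Build R 'M[R[i]]_n.+1
  (@adjmxK n.+1 n.+1) (@adjmxD n.+1 n.+1) (@adjmxZ n.+1 n.+1)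
  (@adjmxM n.+1 n.+1 n.+1).
End MatrixStar.

(* The group structure of [X] is only used to know that [X] is nonempty. *)
Definition Cfun (R : realType) (X : finGroupType) : Type := {ffun X -> R[i]}.

Section FunctionAlgebra.
Variables (R : realType) (X : finGroupType).
Local Notation C := (R[i]).
Local Notation CX := (Cfun R X).
Implicit Types f g : CX.

HB.instance Definition _ := GRing.PzRing.copy CX {ffun X -> R[i]}.
HB.instance Definition _ := GRing.Lmodule.copy CX {ffun X -> R[i]^o}.
HB.instance Definition _ := GRing.PzSemiRing_isNonZero.Build CX
  (@ffun1_nonzero X R[i] 1%g).

Fact Cfun_scalerAl (c : C) f g : c *: (f * g) = (c *: f) * g.
Proof. by apply/ffunP=> x; rewrite !ffunE; apply: mulrA. Qed.
HB.instance Definition _ := GRing.Lmodule_isLalgebra.Build C CX Cfun_scalerAl.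

Fact Cfun_scalerAr (c : C) f g : c *: (f * g) = f * (c *: g).
Proof. by apply/ffunP=> x; rewrite !ffunE; apply: mulrCA. Qed.
HB.instance Definition _ := GRing.Lalgebra_isAlgebra.Build C CX Cfun_scalerAr.

Definition Cfun_star f : CX := [ffun x => (f x)^*].

Fact Cfun_starK : involutive Cfun_star.
Proof. by move=> f; apply/ffunP=> x; rewrite !ffunE conjCK. Qed.
Fact Cfun_starD : {morph Cfun_star : f g / f + g}.
Proof. by move=> f g; apply/ffunP=> x; rewrite !ffunE rmorphD. Qed.
Fact Cfun_starZ (c : C) f : Cfun_star (c *: f) = c^* *: Cfun_star f.
Proof. by apply/ffunP=> x; rewrite !ffunE; apply: rmorphM. Qed.
Fact Cfun_starM f g : Cfun_star (f * g) = Cfun_star g * Cfun_star f.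
Proof. by apply/ffunP=> x; rewrite !ffunE rmorphM mulrC. Qed.
HB.instance Definition _ := isStarAlgebra.Build R CX
  Cfun_starK Cfun_starD Cfun_starZ Cfun_starM.

(* The modulus of a complex number is a complex number: take its real part. *)
Definition supnorm f : R := \big[Num.max/0]_(x : X) complex.Re `|f x|.
Definition Cfun_norm f : C := (supnorm f)%:C%C.

Lemma ReK (z : C) : (complex.Re `|z|)%:C%C = `|z|.
Proof. by case: z => a b. Qed.

Lemma supnorm_ge0 f : 0 <= supnorm f.
Proof. exact: bigmax_ge_id. Qed.

Lemma Cfun_norm_ge f x : `|f x| <= Cfun_norm f.
Proof. by rewrite -ReK lecR; apply: le_bigmax. Qed.

Lemma Cfun_norm_le f (c : C) : 0 <= c -> (forall x, `|f x| <= c) ->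
  Cfun_norm f <= c.
Proof.
case: c => a b; rewrite lecE /= => /andP[/eqP-> a0] H.
rewrite eqxx /=.
apply: bigmax_le => // x _; have := H x.
by rewrite -ReK lecE /= => /andP[].
Qed.

Lemma Cfun_norm_lt f (c : C) : 0 < c -> (forall x, `|f x| < c) ->
  Cfun_norm f < c.
Proof.
case: c => a b; rewrite ltcE /= => /andP[/eqP-> a0] H.
rewrite eqxx /=.
apply: bigmax_lt => // x _; have := H x.
by rewrite -ReK ltcE /= => /andP[].
Qed.

Lemma Cfun_norm_ge0 f : 0 <= Cfun_norm f.
Proof. by rewrite /Cfun_norm ler0c supnorm_ge0. Qed.

Fact Cfun_ler_normD f g : Cfun_norm (f + g) <= Cfun_norm f + Cfun_norm g.
Proof.
apply: Cfun_norm_le => [|x]; first by rewrite addr_ge0 ?Cfun_norm_ge0.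
by rewrite ffunE (le_trans (ler_normD _ _))// lerD// Cfun_norm_ge.
Qed.

Fact Cfun_normrZ (c : C) f : Cfun_norm (c *: f) = `|c| * Cfun_norm f.
Proof.
have ZE d g x : (d *: g : CX) x = d * g x by rewrite ffunE.
have [->|c0] := eqVneq c 0.
  rewrite scale0r normr0 mul0r; apply/eqP; rewrite eq_le Cfun_norm_ge0 andbT.
  by apply: Cfun_norm_le => // x; rewrite ffunE normr0.
have le_Z d g : Cfun_norm (d *: g) <= `|d| * Cfun_norm g.
  apply: Cfun_norm_le => [|x]; first by rewrite mulr_ge0 ?Cfun_norm_ge0.
  by rewrite ZE normrM ler_wpM2l// Cfun_norm_ge.
apply/eqP; rewrite eq_le le_Z /= -ler_pdivlMl ?normr_gt0//.
by rewrite -normfV; have := le_Z c^-1 (c *: f); rewrite scalerA mulVf// scale1r.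
Qed.

Fact Cfun_norm_eq0 f : Cfun_norm f = 0 -> f = 0.
Proof.
move=> f0; apply/ffunP=> x; apply/eqP; rewrite ffunE -normr_le0 -f0.
exact: Cfun_norm_ge.
Qed.

Fact Cfun_normM f g : Cfun_norm (f * g) <= Cfun_norm f * Cfun_norm g.
Proof.
apply: Cfun_norm_le => [|x]; first by rewrite mulr_ge0 ?Cfun_norm_ge0.
by rewrite ffunE normrM ler_pM ?Cfun_norm_ge.
Qed.

Fact Cfun_norm_star f : Cfun_norm (star f * f) = Cfun_norm f ^+ 2.
Proof.
apply/eqP; rewrite eq_le; apply/andP; split.
  apply: Cfun_norm_le => [|x]; first by rewrite exprn_ge0 ?Cfun_norm_ge0.
  by rewrite !ffunE normrM norm_conjC -expr2 lerXn2r ?nnegrE ?Cfun_norm_ge0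
             ?Cfun_norm_ge.
have nn : 0 <= Cfun_norm (star f * f) by apply: Cfun_norm_ge0.
rewrite -[leRHS]sqrtCK lerXn2r ?nnegrE ?Cfun_norm_ge0 ?sqrtC_ge0//.
apply: Cfun_norm_le => [|x]; first by rewrite sqrtC_ge0.
rewrite -[leLHS]sqrCK// ler_sqrtC ?nnegrE ?exprn_ge0//.
apply: le_trans (Cfun_norm_ge _ x).
by rewrite !ffunE normrM norm_conjC -expr2.
Qed.

HB.instance Definition _ := isPreCStarAlgebra.Build R CX
  Cfun_ler_normD Cfun_normrZ Cfun_norm_eq0 Cfun_normM Cfun_norm_star.

Fact Cfun_complete (F : set_system (normed CX)) :
  ProperFilter F -> cauchy F -> cvg F.
Proof.
move=> FF /cauchy_ballP Fc.
have cvg_part (p : C -> R) : (forall a b, p (a - b) = p a - p b) ->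
    (forall z, `|p z|%:C%C <= `|z|) ->
    forall x, cvg ((fun f : normed CX => p ((f : CX) x)) @ F).
  move=> pB ple x; apply: R_complete; apply/cauchy_ballP => e e0.
  have ec0 : 0 < e%:C%C :> C by rewrite ltcE /= eqxx.
  rewrite near_map2.
  apply: filterS (Fc _ ec0) => -[f g] /=.
  rewrite -ball_normE /= => fge.
  rewrite -ball_normE /= -pB -ltcR (le_lt_trans _ fge)//.
  rewrite (le_trans (ple _))//; apply: le_trans (Cfun_norm_ge (f - g) x).
  by rewrite !ffunE.
have pR x := cid ((cvg_ex _).1 (cvg_part (@complex.Re R)
  (fun a b => raddfB (@complex.Re R : Rcomplex R -> R) a b)
  (@normc_ge_Re R) x)).
have Im_le (z : C) : `|complex.Im z|%:C%C <= `|z|.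
  by rewrite normc_def lecR -sqrtr_sqr ler_wsqrtr// lerDr sqr_ge0.
have pI x := cid ((cvg_ex _).1 (cvg_part (@complex.Im R)
  (fun a b => raddfB (@complex.Im R : Rcomplex R -> R) a b) Im_le x)).
pose l : CX := [ffun x => (sval (pR x) +i* sval (pI x))%C].
apply/cvg_ex; exists (l : normed CX); apply/cvgrPdist_lt => e e0.
have : exists r : R, e = r%:C%C /\ 0 < r.
  case: e e0 => a b; rewrite ltcE /= => /andP[/eqP-> a0].
  by exists a.
case=> r [-> r0] {e e0}.
have r20 : 0 < r / 2 by rewrite divr_gt0.
near=> f.
apply: Cfun_norm_lt => [|x]; first by rewrite ltcE /= eqxx.
have hR : `|sval (pR x) - complex.Re ((f : CX) x)| < r / 2.
  move: x; near: f; apply: filter_forall => x.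
  by have /cvgrPdist_lt := svalP (pR x); apply.
have hI : `|sval (pI x) - complex.Im ((f : CX) x)| < r / 2.
  move: x {hR}; near: f; apply: filter_forall => x.
  by have /cvgrPdist_lt := svalP (pI x); apply.
rewrite !ffunE; move: hR hI; case: ((f : CX) x) => a b /= hR hI.
rewrite [X in `|X|]complexE /= (le_lt_trans (ler_normD _ _))//.
rewrite normrM -(_ : 1 = `|'i%C : C|) ?mul1r; last first.
  by rewrite normc_def /= expr0n expr1n add0r sqrtr1.
have -> : r%:C%C = (r / 2)%:C%C + (r / 2)%:C%C :> C.
  by rewrite -(rmorphD (real_complex R)) -splitr.
rewrite ltrD//.
  by rewrite normc_def /= expr0n addr0 sqrtr_sqr ltcR.
by rewrite normc_def /= expr0n addr0 sqrtr_sqr ltcR.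
Unshelve. all: by end_near. Qed.

HB.instance Definition _ := PreCStarAlgebra_isComplete.Build R CX Cfun_complete.
End FunctionAlgebra.

Section MagicUnitary.
Variables (R : realType) (A : starAlgType R).

Definition projection (p : A) := p * p = p /\ star p = p.

Definition partition_of_unity (I : finType) (p : I -> A) :=
  [/\ forall i, projection (p i),
      forall i j, i != j -> p i * p j = 0
    & \sum_i p i = 1].

Definition magic_unitary n (u : 'M[A]_n) :=
  (forall i, partition_of_unity (fun j => u i j)) /\
  (forall j, partition_of_unity (fun i => u i j)).

Definition star_subalgebra (S : set A) :=
  [/\ S 1,
      forall (c : R[i]) x y, S x -> S y -> S (c *: x + y),
      forall x y, S x -> S y -> S (x * y)
    & forall x, S x -> S (star x)].
End MagicUnitary.

(* [A] is generated by the entries of [u] as a C*-algebra. *)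
Definition generated_by (R : realType) (A : cstarType R) n (u : 'M[A]_n) :=
  forall S : set A, star_subalgebra S -> closed (S : set (normed A)) ->
    (forall i j, S (u i j)) -> S = setT.

(* [(A, x)] is a model of the universal C*-algebra [A(S_n)].  The morphism
   [f] is unique, as [x] generates. *)
Definition is_ASn (R : realType) n (A : cstarType R) (x : 'M[A]_n) :=
  [/\ magic_unitary x, generated_by x
    & forall (B : cstarType R) (v : 'M[B]_n), magic_unitary v ->
        exists2 f : A -> B, star_morphism f & forall i j, f (x i j) = v i j].

Section TensorProduct.
Variables (R : realType) (A B : cstarType R).

Definition lin_indep (V : lmodType R[i]) m (b : 'I_m -> V) :=
  forall c : 'I_m -> R[i], \sum_k c k *: b k = 0 -> forall k, c k = 0.

(* [T] is the completion of the algebraic tensor product of [A] and [B] for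
   some C*-norm; [i1 a] and [i2 b] stand for [a (x) 1] and [1 (x) b].  The third
   clause expresses that [a (x) b |-> i1 a * i2 b] is injective on the algebraic
   tensor product. *)
Definition tensor_completion (T : cstarType R) (i1 : A -> T) (i2 : B -> T) :=
  [/\ star_morphism i1 /\ star_morphism i2,
      forall a b, i1 a * i2 b = i2 b * i1 a,
      forall m (a : 'I_m -> A) (b : 'I_m -> B), lin_indep b ->
        \sum_k i1 (a k) * i2 (b k) = 0 -> forall k, a k = 0
    & closure [set t : normed T | exists m (a : 'I_m -> A) (b : 'I_m -> B),
        t = \sum_k i1 (a k) * i2 (b k)] = setT].

(* The minimal C*-tensor product: completion for the least C*-norm. *)
Definition min_tensor (T : cstarType R) (i1 : A -> T) (i2 : B -> T) :=
  tensor_completion i1 i2 /\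
  forall (T' : cstarType R) (j1 : A -> T') (j2 : B -> T'),
    tensor_completion j1 j2 ->
    forall m (a : 'I_m -> A) (b : 'I_m -> B),
      cnorm (\sum_k i1 (a k) * i2 (b k)) <= cnorm (\sum_k j1 (a k) * j2 (b k)).
End TensorProduct.

Section QuantumPermutationAlgebra.
Variables (R : realType) (n : nat).

(* [T] is [A (x) A]; it is determined up to isomorphism. *)
Definition has_comultiplication (A : cstarType R) (u : 'M[A]_n) :=
  exists (T : cstarType R) (i1 i2 : A -> T), min_tensor i1 i2 /\
  exists2 Delta : A -> T, star_morphism Delta &
    forall i j, Delta (u i j) = \sum_k i1 (u i k) * i2 (u k j).

Definition has_counit (A : cstarType R) (u : 'M[A]_n) :=
  exists2 eps : A -> R[i]^o, star_morphism eps &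
    forall i j, eps (u i j) = (i == j)%:R.

Definition has_antipode (A : cstarType R) (u : 'M[A]_n) :=
  exists2 S : A -> A^c, star_morphism S & forall i j, S (u i j) = u j i.

Definition quantum_permutation_algebra (A : cstarType R) (u : 'M[A]_n) :=
  [/\ magic_unitary u, generated_by u, has_comultiplication u, has_counit u
    & has_antipode u].

(* [pi : A(S_n) -> B] factors through [A], with [x i j |-> u i j]. *)
Definition factors_through (ASn : cstarType R) (x : 'M[ASn]_n)
    (B : starAlgType R) (pi : ASn -> B) (A : cstarType R) (u : 'M[A]_n) :=
  exists (p : ASn -> A) (q : A -> B),
    [/\ star_morphism p, star_morphism q, forall i j, p (x i j) = u i j
      & forall a, q (p a) = pi a].

(* [(A, u)] is [A_pi], for a representation [pi] of [A(S_n)]. *)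
Definition is_Api (ASn : cstarType R) (x : 'M[ASn]_n)
    (B : starAlgType R) (pi : ASn -> B) (A : cstarType R) (u : 'M[A]_n) :=
  [/\ quantum_permutation_algebra u, factors_through x pi u
    & forall (A' : cstarType R) (u' : 'M[A']_n),
        quantum_permutation_algebra u' -> factors_through x pi u' ->
        exists f : A' -> A,
          [/\ star_morphism f, range f = setT
            & forall i j, f (u' i j) = u i j]].

Definition qpa_isomorphic (A A' : cstarType R) (u : 'M[A]_n) (u' : 'M[A']_n) :=
  exists f : A -> A',
    [/\ star_morphism f, bijective f & forall i j, f (u i j) = u' i j].
End QuantumPermutationAlgebra.

Section Hadamard.
Variable (R : realType).
Local Notation C := (R[i]).

Definition hadamard n (h : 'M[C]_n) :=
  (forall i j, `|h i j| = 1) /\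
  (forall i j, i != j -> \sum_k h i k * (h j k)^* = 0).

(* The orthogonal projection onto the line spanned by [v != 0]; see
   [line_projP]. *)
Definition line_proj n (v : 'cV[C]_n.+1) : 'M[C]_n.+1 :=
  ((adjmx v *m v) 0 0)^-1 *: (v *m adjmx v).

Lemma line_projP n (v : 'cV[C]_n.+1) : v != 0 ->
  projection (line_proj v) /\
  (forall w : 'cV[C]_n.+1,
    (exists z : 'cV_n.+1, w = line_proj v *m z) <-> (exists c, w = c *: v)).
Proof.
move=> v0; set d := (adjmx v *m v) 0 0.
have dE : d = \sum_k `|v k 0| ^+ 2.
  by rewrite /d mxE; apply: eq_bigr => k _; rewrite !mxE normCKC.
have d0 : d != 0.
  apply: contra v0; rewrite dE psumr_eq0 => [/allP h|k _]; last first.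
    exact: exprn_ge0.
  apply/eqP/matrixP=> k j; rewrite ord1 mxE; apply/eqP.
  by have := h k (mem_index_enum _); rewrite /= expf_eq0 /= normr_eq0.
have vv : adjmx v *m v = d%:M by rewrite [LHS]mx11_scalar.
have Pv : line_proj v *m v = v.
  by rewrite /line_proj -/d -scalemxAl -mulmxA vv mul_mx_scalar scalerA mulVf
             ?scale1r.
split; first split.
- have -> : line_proj v * line_proj v = line_proj v *m line_proj v by [].
  by rewrite {2 3}/line_proj -scalemxAr mulmxA Pv.
- have -> : star (line_proj v) = adjmx (line_proj v) by [].
  rewrite /line_proj -/d adjmxZ adjmxM adjmxK fmorphV; congr (_^-1 *: _).
  by apply/CrealP; rewrite dE; apply: rpred_sum => k _; apply: rpredX; rewrite normr_real.
move=> w; split=> [[z ->]|[c ->]].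
  exists (d^-1 * (adjmx v *m z) 0 0).
  rewrite /line_proj -/d -scalemxAl -mulmxA [adjmx v *m z]mx11_scalar.
  by rewrite mul_mx_scalar scalerA [in RHS]mxE mulr1n.
by exists (c *: v); rewrite -scalemxAr Pv.
Qed.

(* [P_ij] is the projection onto the line spanned by [h_j / h_i]. *)
Definition hadamard_proj n (h : 'M[C]_n.+1) (i j : 'I_n.+1) : 'M[C]_n.+1 :=
  line_proj (\col_k (h j k / h i k)).

(* [(A, u)] is [A(h)]. *)
Definition is_Ah n (ASn : cstarType R) (x : 'M[ASn]_n.+1) (h : 'M[C]_n.+1)
    (A : cstarType R) (u : 'M[A]_n.+1) :=
  hadamard h /\
  exists pi : ASn -> 'M[C]_n.+1,
    [/\ star_morphism pi, forall i j, pi (x i j) = hadamard_proj h i j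
      & is_Api x pi u].

(* [e^(i t)] *)
Definition expi (t : R) : C := (cos t +i* sin t)%C.

(* The indices [1, ..., n] of the Fourier matrix are the [i.+1], [i : 'I_n]. *)
Definition fourier_matrix n : 'M[C]_n :=
  \matrix_(i, j) expi (2 * pi / n%:R) ^+ (i.+1 * j.+1).
End Hadamard.

Section ClassicalGroup.
Variables (R : realType) (n : nat).

(* The function algebra [C(G)] of [G] is [Cfun R (subg_of G)]. *)
Definition chi (G : {group 'S_n}) : 'M[Cfun R (subg_of G)]_n :=
  \matrix_(i, j) ([ffun s => ((sgval s : 'S_n) j == i)%:R] : Cfun R (subg_of G)).

(* [i |-> i - 1] modulo [n], on ['I_n]. *)
Definition cycle_perm : 'S_n := perm (@ord_pred_inj n).

Definition Zn : {group 'S_n} := <[cycle_perm]>%G.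
End ClassicalGroup.

(* Main.v *)
Require Import Defs.
From HB Require Import structures.
From mathcomp Require Import all_boot all_order all_algebra all_fingroup.
From mathcomp Require Import complex.
From mathcomp Require Import all_classical all_reals all_analysis.
Set Implicit Arguments.
Unset Strict Implicit.
Unset Printing Implicit Defensive.
Import Order.TTheory GRing.Theory Num.Theory.
Import numFieldNormedType.Exports.
Local Open Scope classical_set_scope.
Local Open Scope ring_scope.

(** With [w = e^(2 i pi / N)], the quotient [F_j / F_i] of two rows of the
    Fourier matrix is the character [k |-> w^((j - i) k)], so that [P_ij] only
    depends on [j - i] modulo [N], that is on the unique [s] in [Z_N] with
    [s j = i] ([fourier_proj_Zn], [Zn_free]).  The [N] distinct projections are
    orthogonal, of rank one, and sum to [1] ([hadamard_partition]); the matrices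
    that are diagonal for them form a copy of [C(Z_N)], in which [P_ij] is the
    indicator function [chi i j] ([pou_fun_chi]).

    The key point is [factor_fourier]: let [phi : A -> M_N] be a morphism from a
    C*-algebra generated by elements [u i j] that [phi] maps to [P_ij].  The
    elements with a diagonal image form a closed *-subalgebra, hence all of [A],
    and [phi] factors as [A -> C(Z_N) -> M_N], with [u i j |-> chi i j].  For
    [A = A(S_N)] this is the factorization of the representation through
    [C(Z_N)]; for any other quantum permutation algebra factoring it, this is
    the surjection onto [C(Z_N)] required by minimality ([chi_is_Api]).

    That the elements with a diagonal image are closed is a form of the
    continuity of [phi].  It follows from a bound on eigenvalues
    ([eigenvalue_le_cnorm]): if [phi y] has the eigenvalue [c], then
    [`|c| <= cnorm y], since otherwise the geometric series of [y / c] converges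
    and its image under [phi] is contradictory.

    That [C(Z_N)] is a quantum permutation algebra holds for every permutation
    group [G]; the tensor square of [C(G)] is [C(G * G)], as the supremum norm
    is dominated by every C*-norm ([min_tensor_Cfun]).  Uniqueness is formal:
    minimality gives morphisms [f] and [g] in both directions, [g] is
    surjective, and [f \o g] is the identity as it fixes the [chi i j]. *)

(** * Star morphisms *)

Section StarMorphism.
Variables (R : realType) (A B : starAlgType R) (f : A -> B).
Hypothesis fP : star_morphism f.

Lemma star_morphD a b : f (a + b) = f a + f b.
Proof. by have [lin _ _] := fP; have := lin 1 a b; rewrite !scale1r. Qed.

Lemma star_morph0 : f 0 = 0.
Proof. by apply: (addrI (f 0)); rewrite -star_morphD !addr0. Qed.

Lemma star_morphZ c a : f (c *: a) = c *: f a.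
Proof. by have [lin _ _] := fP; have := lin c a 0; rewrite
  !addr0 star_morph0 addr0. Qed.

Lemma star_morphB a b : f (a - b) = f a - f b.
Proof. by rewrite -scaleN1r star_morphD star_morphZ scaleN1r. Qed.

Lemma star_morph1 : f 1 = 1.
Proof. by have [_ []] := fP. Qed.

Lemma star_morphM a b : f (a * b) = f a * f b.
Proof. by have [_ []] := fP. Qed.

Lemma star_morph_star a : f (star a) = star (f a).
Proof. by have [_ _] := fP. Qed.

Lemma star_morphism_comp (D : starAlgType R) (g : B -> D) :
  star_morphism g -> star_morphism (g \o f).
Proof.
move: fP => [linf [f1 fM] fs] [ling [g1 gM] gs]; split.
- by move=> c a b /=; rewrite linf ling.
- by split=> [|a b] /=; rewrite ?f1 ?g1 // fM gM.
- by move=> a /=; rewrite fs gs.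
Qed.
End StarMorphism.

Section StarAlgebra.
Variables (R : realType) (A : starAlgType R).

Lemma star0 : star (0 : A) = 0.
Proof. by have := @starZ R A 0 0; rewrite conjC0 !scale0r. Qed.

Lemma star_sum (I : Type) (r : seq I) (F : I -> A) :
  star (\sum_(i <- r) F i) = \sum_(i <- r) star (F i).
Proof. exact: (big_morph (@star R A) (@starD R A) star0). Qed.

Lemma star_subalgebra_sum (S : set A) (I : Type) (r : seq I) (F : I -> A) :
  star_subalgebra S -> (forall i, S (F i)) -> S (\sum_(i <- r) F i).
Proof.
move=> [S1 Sl _ _] SF.
elim/big_rec: _ => [|i a _ Sa]; last by rewrite -[F i]scale1r; apply: Sl.
by have := Sl (-1) _ _ S1 S1; rewrite scaleN1r addNr.
Qed.
End StarAlgebra.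

(** * A bound on the eigenvalues of images of elements of a C*-algebra *)

Section EigenvalueBound.
Variables (R : realType) (A : cstarType R).
Local Notation C := (R[i]).
Implicit Types (a b y z : A).

Lemma cnorm_ge0 a : 0 <= cnorm a.
Proof. exact: (normr_ge0 (a : normed A)). Qed.

Lemma cnorm0 : cnorm (0 : A) = 0.
Proof. exact: (normr0 (normed A)). Qed.

Lemma cnormB a b : cnorm (a - b) = cnorm (b - a).
Proof. exact: (distrC (a : normed A) b). Qed.

Fixpoint geom_sum y m : A := if m is k.+1 then y + geom_sum y k * y else 0.

(** [z] is the sum of the geometric series of the [y ^+ k], [k > 0], whose
    partial sums are the [geom_sum y m].  It exists by completeness. *)
Lemma geometric_fixpoint y : cnorm y < 1 -> exists z, z = y + z * y.
Proof.
move=> y1.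
pose s (m : nat) : normed A := geom_sum y m.
pose r := complex.Re (cnorm y).
have rE : cnorm y = r%:C%C.
  by move: (cnorm_ge0 y); rewrite /r; case: (cnorm y) => u v;
     rewrite lecE /= => /andP[/eqP -> _].
have r0 : 0 <= r by move: (cnorm_ge0 y); rewrite rE ler0c.
have r1 : r < 1 by move: y1; rewrite rE -(ltcR r).
have sk (m k : nat) : cnorm (geom_sum y (m + k) - geom_sum y m)
    <= cnorm (geom_sum y k) * cnorm y ^+ m.
  elim: m k => [|m IH] k; first by rewrite add0n subr0 expr0 mulr1.
  rewrite addSn /= addrAC opprD addrA subrr add0r -mulNr -mulrDl [- _ + _]addrC.
  rewrite (le_trans (cnormM _ _)) // exprSr mulrA ler_wpM2r ?cnorm_ge0 //.
have [K K0 sK] : exists2 K : R, 0 < K & forall k, cnorm (geom_sum y k) <=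
  K%:C%C.
  exists (1 - r)^-1 => [|k]; first by rewrite invr_gt0 subr_gt0.
  have K0 : 0 <= (1 - r)^-1 by rewrite invr_ge0 subr_ge0 ltW.
  elim: k => [|k IH]; first by rewrite cnorm0 ler0c.
  rewrite /= (le_trans (cnormD _ _)) //.
  apply: (@le_trans _ _ (r%:C + (1 - r)^-1%:C * r%:C)%C).
    rewrite rE lerD // (le_trans (cnormM _ _)) // -rE ler_wpM2r ?cnorm_ge0 //.
  have KE : (1 - r)^-1 * r = (1 - r)^-1 - 1.
    have d0 : 1 - r != 0 by rewrite gt_eqF // subr_gt0.
    apply/eqP; rewrite eq_sym subr_eq [_ * r + 1]addrC -subr_eq.
    by rewrite -[X in X - _]mulr1 -mulrBr mulVf.
  by rewrite -rmorphM -rmorphD lecR KE addrCA gerDl subr_le0 ltW.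
have sc : cauchy (s @ \oo).
  apply: cauchy_exP => e e0.
  have [d eE d0] : exists2 d : R, e = d%:C%C & 0 < d.
    case: e e0 => u v; rewrite ltcE /= => /andP[/eqP-> u0].
    by exists u.
  have /cvgrPdist_lt/(_ (d / K)) : GRing.exp r @ \oo --> (0 : R).
    by apply: cvg_expr; rewrite ger0_norm.
  move=> /(_ (divr_gt0 d0 K0))[m _ /(_ m (leqnn m))] /=.
  rewrite sub0r normrN ger0_norm ?exprn_ge0 // ltr_pdivlMr // => rm.
  exists (s m); exists m => // k /= mk.
  rewrite -ball_normE /= -(subnKC mk) distrC.
  rewrite (le_lt_trans (sk _ _)) // eE.
  apply: (@le_lt_trans _ _ (K%:C * (r ^+ m)%:C)%C).
    by rewrite rE -rmorphXn /= ler_wpM2r // ler0c exprn_ge0.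
  by rewrite -rmorphM ltcR mulrC.
have [z /cvgrPdist_lt zP] := (cvg_ex _).1 (cstar_complete _ _ sc).
exists z; apply/eqP; rewrite -subr_eq0; apply/eqP/cnorm_eq0.
apply/eqP/negPn/negP => d0.
have {}d0 : 0 < cnorm (z - (y + z * y)) / 2.
  by rewrite divr_gt0 // lt_def d0 cnorm_ge0.
have [m _ mz] := zP _ d0.
have zm k : (m <= k)%N -> cnorm (z - geom_sum y k) < cnorm (z - (y + z * y)) / 2.
  by move=> /mz.
have dE : z - (y + z * y) = (z - geom_sum y m.+1) + (geom_sum y m - z) * y.
  by rewrite /= mulrBl !opprD ![z + (_ - _)]addrA subrKA.
have dle : cnorm (z - (y + z * y))
    <= cnorm (z - geom_sum y m.+1) + cnorm (z - geom_sum y m).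
  rewrite {1}dE (le_trans (cnormD _ _)) // lerD2l (le_trans (cnormM _ _)) //.
  by rewrite cnormB ler_piMr ?cnorm_ge0 // ltW.
have := le_lt_trans dle (ltrD (zm _ (leqnSn m)) (zm _ (leqnn m))).
by rewrite -splitr ltxx.
Qed.

(** A fixed point [z = y + z * y] would give [f z * e = e + f z * e] as soon as
    [f y * e = e]: the spectral radius of [f y] is thus at most [cnorm y], and
    no norm on the codomain is needed. *)
Lemma eigenvalue_le_cnorm (B : starAlgType R) (f : A -> B) y e (c : C) :
  star_morphism f -> f y * e = c *: e -> e != 0 -> `|c| <= cnorm y.
Proof.
move=> fP fy e0.
case: (real_leP (normr_real c) (ger0_real (cnorm_ge0 y))) => // ltyc.
have c0 : c != 0 by rewrite -normr_gt0 (le_lt_trans (cnorm_ge0 y)).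
have [|z zE] := @geometric_fixpoint (c^-1 *: y).
  by rewrite cnormZ normfV mulrC ltr_pdivrMr ?normr_gt0 // mul1r.
have fye : f (c^-1 *: y) * e = e.
  by rewrite (star_morphZ fP) -scalerAl fy scalerA mulVf // scale1r.
have : f z * e = e + f z * e.
  by rewrite {1}zE (star_morphD fP) (star_morphM fP) mulrDl -mulrA fye.
by move/eqP; rewrite -subr_eq subrr eq_sym (negPf e0).
Qed.
End EigenvalueBound.

(** * Functions of a partition of unity by minimal projections *)

Section PartitionCalculus.
Variables (R : realType) (X : finGroupType) (B : starAlgType R) (Q : X -> B).
Hypothesis QP : partition_of_unity Q.

Definition pou_fun (g : Cfun R X) : B := \sum_s g s *: Q s.

(** The [Q s] diagonalize the functions of [Q]; this gives the multiplicativity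
    and the injectivity of [pou_fun]. *)
Lemma mul_pou_fun s g : Q s * pou_fun g = g s *: Q s.
Proof.
have [Qproj Q0 _] := QP; rewrite mulr_sumr (bigD1 s) //= big1 => [|t ts].
  by rewrite addr0 -scalerAr; have [-> _] := Qproj s.
by rewrite -scalerAr Q0 1?eq_sym // scaler0.
Qed.

Lemma pou_fun_star_morphism : star_morphism pou_fun.
Proof.
have [Qproj Q0 Q1] := QP; split.
- move=> c g h; rewrite scaler_sumr -big_split; apply: eq_bigr => s _ /=.
  by rewrite !ffunE scalerDl scalerA.
- split=> [|g h]; last first.
    rewrite {2}/pou_fun mulr_suml; apply: eq_bigr => s _.
    by rewrite -scalerAl mul_pou_fun scalerA ffunE.
  by rewrite -Q1; apply: eq_bigr => s _; rewrite ffunE scale1r.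
- move=> g; rewrite star_sum; apply: eq_bigr => s _.
  by rewrite starZ ffunE; have [_ ->] := Qproj s.
Qed.

Lemma pou_fun_inj : (forall s, Q s != 0) -> injective pou_fun.
Proof.
move=> Qn0 g h gh; apply/ffunP => s.
have := congr1 (fun b => Q s * b) gh; rewrite /= !mul_pou_fun => /eqP.
by rewrite -subr_eq0 -scalerBl scaler_eq0 (negPf (Qn0 s)) orbF subr_eq0 => /eqP.
Qed.

Hypothesis Qmin : forall s b, exists c : R[i], Q s * b * Q s = c *: Q s.

(** [b] is the sum of its corners [Q s * b * Q t]; the diagonal ones are scalar
    multiples of the [Q s]. *)
Lemma pou_fun_diagonal b :
  (forall s t, s != t -> Q s * b * Q t = 0) -> exists g, b = pou_fun g.
Proof.
move=> bdiag; have [_ _ Q1] := QP.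
pose g : Cfun R X := [ffun s => sval (cid (Qmin s b))].
exists g; rewrite -[LHS]mulr1 -[b]mul1r -Q1 !mulr_suml; apply: eq_bigr => s _.
rewrite mulr_sumr (bigD1 s) //= big1 => [|t ts]; last by
  rewrite bdiag // eq_sym.
by rewrite addr0 ffunE; case: cid.
Qed.

Hypothesis Bproper : forall b : B, star b * b = 0 -> b = 0.

Section Lift.
Variables (A : cstarType R) (phi : A -> B).
Hypothesis phiP : star_morphism phi.
Hypothesis phiQ : forall s, exists a, phi a = Q s.

(** If [b] tends to [a] among the elements with [phi b] diagonal, then
    [y = p s * (a - b) * p t] tends to [0], where [phi (p s) = Q s], whereas
    [phi (star y * y)] is the constant multiple [c *: Q t] of [Q t] by
    minimality; the eigenvalue bound forces [c = 0].  This replaces the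
    automatic continuity of [phi], which would need a norm on [B]. *)
Lemma closed_preimage_pou_fun :
  closed ([set a | exists g, phi a = pou_fun g] : set (normed A)).
Proof.
have [Qproj Q0 _] := QP.
suff clS : closure ([set a | exists g, phi a = pou_fun g] : set (normed A))
    `<=` [set a | exists g, phi a = pou_fun g].
  by apply/closure_id/seteqP; split=> //; exact: subset_closure.
move=> a cla /=; apply: pou_fun_diagonal => s t st.
have [ps psE] := phiQ s; have [pt ptE] := phiQ t.
have [c cE] := Qmin t (star (phi a) * Q s * phi a).
have yy : star (Q s * phi a * Q t) * (Q s * phi a * Q t) = c *: Q t.
  rewrite !starM (Qproj s).2 (Qproj t).2 -cE !mulrA.
  by rewrite -(mulrA _ (Q s) (Q s)) (Qproj s).1.
have [Qt0|Qt0] := eqVneq (Q t) 0; first by rewrite Qt0 mulr0.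
have [c0|c0] := eqVneq c 0; first by apply: Bproper; rewrite yy c0 scale0r.
pose K := cnorm ps * cnorm pt.
have K0 : 0 <= K by rewrite mulr_ge0 ?cnorm_ge0.
have e0 : 0 < sqrtC `|c| / (K + 1).
  by rewrite divr_gt0 ?sqrtC_gt0 ?normr_gt0 // ltr_wpDl.
have [b [[g bg] /= ab]] := cla _ (nbhsx_ballx (a : normed A) _ e0).
move: ab; rewrite -ball_normE /= ltr_pdivlMr ?ltr_wpDl // => ab.
(* the corner of [phi b] vanishes, so that [phi y] does not depend on [b] *)
pose y := ps * (a - b) * pt.
have phiy : phi y = Q s * phi a * Q t.
  rewrite !(star_morphM phiP)
    (star_morphB phiP) psE ptE bg mulrBr mulrBl mul_pou_fun -scalerAl.
  by rewrite Q0 // scaler0 subr0.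
have : `|c| <= cnorm (star y * y).
  apply: (eigenvalue_le_cnorm phiP _ Qt0).
  by rewrite (star_morphM phiP)
    (star_morph_star phiP) phiy yy -scalerAl (Qproj t).1.
rewrite cnorm_star -[leLHS]sqrtCK ler_pXn2r ?nnegrE ?sqrtC_ge0 ?cnorm_ge0 //
  => cy.
have yK : cnorm y <= cnorm (a - b) * K.
  rewrite (le_trans (cnormM _ _)) // /K mulrA ler_wpM2r ?cnorm_ge0 //.
  by rewrite [leRHS]mulrC cnormM.
have := lt_le_trans ab (le_trans cy yK).
by rewrite mulrDr mulr1 gtrDl le_gtF ?cnorm_ge0.
Qed.

Variables (m : nat) (u : 'M[A]_m).
Hypothesis ugen : generated_by u.
Hypothesis phiu : forall i j, exists g, phi (u i j) = pou_fun g.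

(** All values of [phi] are in the image of the injective morphism [pou_fun],
    whose inverse can then be composed with [phi]. *)
Lemma factor_pou_fun : (forall s, Q s != 0) ->
  exists2 f : A -> Cfun R X, star_morphism f &
    forall a, pou_fun (f a) = phi a.
Proof.
move=> Qn0; have qP := pou_fun_star_morphism; have qI := pou_fun_inj Qn0.
have imS (a : A) : exists g, phi a = pou_fun g.
  suff : [set a | exists g, phi a = pou_fun g] = setT :> set A.
    by move/seteqP => [_ /(_ a I)].
  apply: ugen => //; last exact: closed_preimage_pou_fun.
  split=> /=.
  - by exists 1; rewrite (star_morph1 phiP) (star_morph1 qP).
  - move=> c x y [g xg] [h yh]; exists (c *: g + h).
    by rewrite (star_morphD phiP) (star_morphZ phiP) (star_morphD qP)
      (star_morphZ qP) xg yh.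
  - by move=> x y [g xg] [h yh]; exists (g * h); rewrite (star_morphM phiP)
      (star_morphM qP) xg yh.
  - by move=> x [g xg]; exists (star g); rewrite (star_morph_star phiP)
      (star_morph_star qP) xg.
pose f a := sval (cid (imS a)).
have fE a : pou_fun (f a) = phi a by rewrite /f; case: cid.
exists f => //; split.
- move=> c x y; apply: qI.
  by rewrite (star_morphD qP) (star_morphZ qP) !fE (star_morphD phiP)
    (star_morphZ phiP).
- split=> [|x y]; apply: qI; first by rewrite fE (star_morph1 phiP)
    (star_morph1 qP).
  by rewrite (star_morphM qP) !fE (star_morphM phiP).
- by move=> x; apply: qI; rewrite (star_morph_star qP) !fE
    (star_morph_star phiP).
Qed.
End Lift.
End PartitionCalculus.

(** * The quantum permutation algebra of a finite permutation group *)

Section Functions.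
Variables (R : realType) (X : finGroupType).
Implicit Types (f g : Cfun R X) (s : X).

Definition delta s : Cfun R X := [ffun t => (t == s)%:R].

Lemma Cfun_sumE (I : Type) (r : seq I) (F : I -> Cfun R X) s :
  (\sum_(i <- r) F i) s = \sum_(i <- r) F i s.
Proof.
by apply: (big_morph (fun f : Cfun R X => f s)) => [f g|]; rewrite ffunE.
Qed.

Lemma Cfun_sum_delta f : f = \sum_s f s *: delta s.
Proof.
apply/ffunP => t; rewrite Cfun_sumE (bigD1 t) //= big1 => [|s st].
  by rewrite !ffunE eqxx addr0 [RHS]mulr1.
by rewrite !ffunE eq_sym (negPf st) [LHS]mulr0.
Qed.

Lemma delta_mul s f : delta s * f = f s *: delta s.
Proof.
apply/ffunP => t; rewrite !ffunE; have [->|_] := eqVneq t s.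
  by rewrite mul1r [RHS]mulr1.
by rewrite mul0r [RHS]mulr0.
Qed.

Lemma delta_neq0 s : delta s != 0.
Proof.
by apply/eqP => /ffunP/(_ s)/eqP; rewrite !ffunE eqxx oner_eq0.
Qed.
End Functions.

Section Pullback.
Variables (R : realType) (X Y : finGroupType) (r : Y -> X).

Definition pullback (f : Cfun R X) : Cfun R Y := [ffun y => f (r y)].

Lemma pullback_star_morphism : star_morphism pullback.
Proof.
split; first by move=> c f g; apply/ffunP => y; rewrite !ffunE.
  by split=> [|f g]; apply/ffunP => y; rewrite !ffunE.
by move=> f; apply/ffunP => y; rewrite !ffunE.
Qed.
End Pullback.

(** In any completion, [delta s] and [delta t] have a nonzero product [e], by
    injectivity, and [e] is an eigenvector of every elementary sum, the
    eigenvalue being the value of this sum at [(s, t)].  So no C*-norm can be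
    smaller than the supremum norm. *)
Lemma min_tensor_Cfun (R : realType) (X Y : finGroupType) :
  min_tensor (pullback (R := R) (@fst X Y)) (pullback (R := R) (@snd X Y)).
Proof.
split; first split.
- by split; exact: pullback_star_morphism.
- by move=> f g; apply/ffunP => z; rewrite !ffunE mulrC.
- move=> m a b bfree ab0 k; apply/ffunP => s; rewrite [RHS]ffunE; move: k.
  apply: bfree; apply/ffunP => t.
  rewrite Cfun_sumE [RHS]ffunE; have /ffunP/(_ (s, t)) := ab0.
  rewrite Cfun_sumE [RHS]ffunE => {2}<-.
  by apply: eq_bigr => k _; rewrite !ffunE.
- apply/seteqP; split=> // f _; apply: subset_closure.
  exists #|X|, (fun k => delta R (enum_val k)),
    (fun k => [ffun t => f (enum_val k, t)]).
  apply/ffunP => -[s t].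
  rewrite Cfun_sumE (bigD1 (enum_rank s)) //= big1 => [|k ks].
    by rewrite !ffunE enum_rankK /= eqxx mul1r addr0.
  rewrite !ffunE /= (_ : (s == _) = false) ?mul0r //.
  by apply: contraNF ks => /eqP ->; rewrite enum_valK.
move=> T' j1 j2 [[j1P j2P] jC jI _] m a b.
apply: Cfun_norm_le => [|[s t]]; first exact: cnorm_ge0.
pose e := j1 (delta R s) * j2 (delta R t).
have e0 : e != 0.
  apply/eqP => e0.
  have free1 : lin_indep (fun _ : 'I_1 => delta R t).
    move=> c; rewrite big_ord1 => /eqP.
    rewrite scaler_eq0 (negPf (delta_neq0 _ _)) orbF => /eqP c0 k.
    by rewrite ord1.
  have := jI 1%N (fun _ => delta R s) _ free1.
  rewrite big_ord1 => /(_ e0 ord0)/eqP.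
  by rewrite (negPf (delta_neq0 _ _)).
have eE : e * (\sum_k j1 (a k) * j2 (b k)) = (\sum_k a k s * b k t) *: e.
  rewrite mulr_sumr scaler_suml; apply: eq_bigr => k _.
  rewrite /e mulrA -(mulrA (j1 _)) -jC mulrA -(star_morphM j1P) -mulrA -(star_morphM j2P).
  by rewrite !delta_mul (star_morphZ j1P)
    (star_morphZ j2P) -scalerAl -scalerAr scalerA.
rewrite Cfun_sumE (eq_bigr (fun k => a k s * b k t)) => [|k _]; last first.
  by rewrite !ffunE.
have ce0 : 0 < cnorm e.
  rewrite lt_def cnorm_ge0 andbT; apply: contra e0 => /eqP ce0.
  exact/eqP/cnorm_eq0.
by rewrite -(ler_pM2r ce0) -cnormZ -eE [leRHS]mulrC cnormM.
Qed.

Section PermutationGroup.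
Variables (R : realType) (n : nat) (G : {group 'S_n}).
Local Notation X := (subg_of G).
Local Notation chiG := (chi R G).

Lemma chiE i j (s : X) : chiG i j s = (sgval s j == i)%:R.
Proof. by rewrite mxE ffunE. Qed.

Lemma chi_magic : magic_unitary chiG.
Proof.
have bb (b : bool) : b%:R * b%:R = b%:R :> R[i] by case: b; rewrite ?mulr1
  ?mulr0.
have chi_proj i j : projection (chiG i j).
  split; apply/ffunP => s; first by rewrite [LHS]ffunE chiE bb.
  by rewrite [LHS]ffunE chiE conjC_nat.
split=> [i|j]; split=> //.
- move=> j k jk; apply/ffunP => s; rewrite [LHS]ffunE
    !chiE [RHS]ffunE -natrM mulnb.
  case: eqP => //= <-; rewrite (inj_eq perm_inj).
  by rewrite eq_sym (negPf jk).
- apply/ffunP => s; rewrite Cfun_sumE [RHS]ffunE.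
  rewrite (bigD1 ((sgval s)^-1%g i)) //= big1 => [|j ji]; last first.
    rewrite chiE; case: eqP => // sji.
    by rewrite -sji permK eqxx in ji.
  by rewrite chiE permKV eqxx addr0.
- move=> i k ik; apply/ffunP => s; rewrite [LHS]ffunE
    !chiE [RHS]ffunE -natrM mulnb.
  by case: eqP => //= ->; rewrite (negPf ik).
- apply/ffunP => s; rewrite Cfun_sumE [RHS]ffunE.
  rewrite (bigD1 (sgval s j)) //= big1 => [|i ij]; last first.
    by rewrite chiE eq_sym (negPf ij).
  by rewrite chiE eqxx addr0.
Qed.

(** A permutation is determined by its values. *)
Lemma delta_prod_chi (s : X) : delta R s = \prod_j chiG (sgval s j) j.
Proof.
apply/ffunP => t.
rewrite (big_morph (fun f : Cfun R X => f t) (id1 := 1) (op1 := *%R)) /=; last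
  first.
- by rewrite ffunE.
- by move=> f g; rewrite ffunE.
rewrite ffunE; have [<-|ts] := eqVneq t s.
  by rewrite big1 // => j _; rewrite chiE eqxx.
have [j tsj] : exists j, sgval t j != sgval s j.
  apply/existsP; rewrite -negb_forall; apply: contra ts => /forallP ts.
  by apply/eqP/val_inj/permP => j; apply/eqP.
by rewrite (bigD1 j) //= chiE (negPf tsj) mul0r.
Qed.

(** The indicator functions of points being products of entries of [chi], these
    entries generate [C(G)] algebraically, without taking closures. *)
Lemma star_subalgebra_chi (S : set (Cfun R X)) : star_subalgebra S ->
  (forall i j, S (chiG i j)) -> S = setT.
Proof.
move=> SP Schi; apply/seteqP; split=> // f _.
rewrite [f]Cfun_sum_delta; apply: star_subalgebra_sum => // s.
have [S1 Sl SM _] := SP.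
have S0 : S 0 by have := Sl (-1) _ _ S1 S1; rewrite scaleN1r addNr.
rewrite -[_ *: _]addr0; apply: Sl => //; rewrite delta_prod_chi.
by elim/big_rec: _ => // j g _; apply: SM.
Qed.

Lemma chi_comultiplication : has_comultiplication chiG.
Proof.
exists (Cfun R (X * X)%type), (pullback (@fst X X)), (pullback (@snd X X)).
split; first exact: min_tensor_Cfun.
(* the product of permutations composes from left to right *)
exists (pullback (fun st : X * X => (st.2 * st.1)%g)).
  exact: pullback_star_morphism.
move=> i j; apply/ffunP => -[s t].
rewrite Cfun_sumE ffunE chiE /= permM.
rewrite (bigD1 (sgval t j)) //= big1 => [|k kj].
  by rewrite !ffunE !chiE /= eqxx mulr1 addr0.
by rewrite !ffunE !chiE /= [sgval t j == _]eq_sym (negPf kj) mulr0.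
Qed.

Lemma chi_counit : has_counit chiG.
Proof.
exists (fun f : Cfun R X => f 1%g) => [|i j]; last by rewrite chiE perm1 eq_sym.
split=> [c f g|| f]; rewrite ?ffunE //.
by split=> [|f g]; rewrite ffunE.
Qed.

Lemma chi_antipode : has_antipode chiG.
Proof.
have [lin [f1 fM] fs] := pullback_star_morphism R (fun s : X => s^-1%g).
exists (pullback (fun s : X => s^-1%g)) => [|i j]; last first.
  apply/ffunP => s; rewrite ffunE !chiE /=.
  by rewrite (can2_eq (permKV _) (permK _)) eq_sym.
split=> //; split=> // f g.
by rewrite fM; apply/ffunP => s; rewrite !ffunE mulrC.
Qed.

Lemma chi_quantum_permutation_algebra : quantum_permutation_algebra chiG.
Proof.
split; [exact: chi_magic | | exact: chi_comultiplication | exact: chi_counit |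
  exact: chi_antipode].
by move=> S SP _; exact: star_subalgebra_chi.
Qed.
End PermutationGroup.

(** * Rank one projections and Hadamard matrices *)

Section MatrixAlgebra.
Variables (R : realType) (n : nat).
Local Notation C := (R[i]).
Local Notation M := ('M[C]_n.+1).
Implicit Types (b : M) (v w : 'cV[C]_n.+1).

Lemma star_mul_eq0 b : star b * b = 0 -> b = 0.
Proof.
move=> bb0; apply/matrixP => k j; rewrite mxE.
have /matrixP/(_ j j) := bb0; rewrite [RHS]mxE mxE.
under eq_bigr do rewrite !mxE -normCKC.
move/psumr_eq0P => b0; apply/eqP; rewrite -normr_eq0 -sqrf_eq0.
by apply/eqP/b0 => // i _; rewrite exprn_ge0.
Qed.

(** [v v^* b v v^*] is the multiple of [v v^*] by the scalar [v^* b v]. *)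
Lemma line_proj_minimal v b :
  exists c : C, line_proj v * b * line_proj v = c *: line_proj v.
Proof.
exists (((adjmx v *m v) 0 0)^-1 * (adjmx v *m b *m v) 0 0).
rewrite /line_proj; set d := _^-1.
transitivity (d * d *: (v *m (adjmx v *m b *m v) *m adjmx v)).
  rewrite -scalerAl -scalerAl -scalerAr scalerA; congr (_ *: _).
  by rewrite -!mulmxE !mulmxA.
rewrite [X in v *m X]mx11_scalar mul_mx_scalar -scalemxAl !scalerA.
by rewrite [in RHS]mulrAC.
Qed.

Lemma line_proj_orthogonal v w :
  adjmx v *m w = 0 -> line_proj v * line_proj w = 0.
Proof.
move=> vw; rewrite /line_proj -scalerAl -scalerAr -mulmxE mulmxA.
by rewrite -(mulmxA v) vw mulmx0 mul0mx !scaler0.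
Qed.

Variable h : M.
Hypothesis hP : hadamard h.
Local Notation col i j := (\col_k (h j k / h i k) : 'cV[C]_n.+1).

Lemma hadamard_dot i m j :
  adjmx (col i j) *m col m j = (n.+1 * (i == m))%:R%:M.
Proof.
have [h1 h0] := hP.
have hV a k : (h a k)^-1 = (h a k)^* by rewrite invC_norm h1 expr1n invr1 mul1r.
have -> : adjmx (col i j) *m col m j = (\sum_k h i k * (h m k)^*)%:M.
  rewrite [LHS]mx11_scalar mxE; congr (_%:M); apply: eq_bigr => k _.
  rewrite !mxE !hV rmorphM /= conjCK mulrACA.
  by rewrite -normCKC h1 expr1n mul1r.
have [<-|im] := eqVneq i m; last by rewrite h0 // muln0.
rewrite muln1; congr (_%:M); under eq_bigr do rewrite -normCK h1 expr1n.
by rewrite sumr_const card_ord.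
Qed.

Lemma hadamard_col_neq0 i j : col i j != 0.
Proof.
apply/eqP => c0; have := hadamard_dot i i j; rewrite c0 mulmx0 eqxx muln1.
by move/matrixP/(_ 0 0)/eqP; rewrite !mxE mulr1n eq_sym pnatr_eq0.
Qed.

Lemma hadamard_proj_neq0 i j : hadamard_proj h i j != 0.
Proof.
have [_ /(_ (col i j)) [_ imP]] := line_projP (hadamard_col_neq0 i j).
have [|z zE] := imP; first by exists 1; rewrite scale1r.
apply: contra (hadamard_col_neq0 i j) => /eqP P0.
by rewrite zE -/(hadamard_proj h i j) P0 mul0mx.
Qed.

(** The vectors [h_j / h_i], [i] varying, are orthogonal of the same norm as
    the rows of [h]; being as many as the dimension, they form a basis. *)
Lemma hadamard_partition j : partition_of_unity (fun i => hadamard_proj h i j).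
Proof.
split=> [i|i m im|].
- by have [] := line_projP (hadamard_col_neq0 i j).
- apply: line_proj_orthogonal; rewrite hadamard_dot (negPf im) muln0.
  by rewrite raddf0.
(* the square matrix of these vectors is left invertible, hence invertible *)
pose V : M := \matrix_(k, i) (h j k / h i k).
have VV : (n.+1%:R^-1 *: adjmx V) *m V = 1%:M.
  rewrite -scalemxAl; apply/matrixP => i m.
  transitivity (n.+1%:R^-1 * (adjmx (col i j) *m col m j) 0 0).
    by rewrite 2!mxE; congr (_ * _); rewrite mxE; apply: eq_bigr => k _;
       rewrite !mxE.
  by rewrite hadamard_dot !mxE mulr1n natrM mulrA mulVf ?mul1r //.
have -> : 1 = V *m (n.+1%:R^-1 *: adjmx V) by rewrite (mulmx1C VV).
apply/matrixP => k l; rewrite summxE mxE; apply: eq_bigr => i _.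
rewrite /hadamard_proj /line_proj hadamard_dot eqxx muln1 !mxE big_ord1 !mxE.
by rewrite mulr1n mulrCA.
Qed.
End MatrixAlgebra.

Lemma partition_of_unity_reindex (R : realType) (A : starAlgType R)
    (I J : finType) (p : I -> A) (r : J -> I) :
  bijective r -> partition_of_unity p -> partition_of_unity (p \o r).
Proof.
move=> rbij [pproj p0 p1]; split=> [j|j k jk|]; first exact: pproj.
  by apply: p0; rewrite (inj_eq (bij_inj rbij)).
by rewrite -p1 [RHS](reindex r) //; apply: onW_bij.
Qed.

(** * The Fourier matrix *)

Section RootOfUnity.
Variable R : realType.
Local Notation C := (R[i]).
Implicit Types (s t : R).

Lemma expiD s t : expi (s + t) = expi s * expi t.
Proof. by rewrite /expi cosD sinD [sin s * _ + _]addrC. Qed.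

Lemma expiX t m : expi t ^+ m = expi (t * m%:R).
Proof.
elim: m => [|m IH]; first by rewrite mulr0 /expi cos0 sin0.
by rewrite exprSr IH -expiD -[m.+1]addn1 natrD mulrDr mulr1.
Qed.

Lemma norm_expi t : `|expi t| = 1.
Proof. by rewrite normc_def /= cos2Dsin2 sqrtr1. Qed.

(** [cos t = 1] would give [sin (t / 2) = 0] with [t / 2]
    strictly between [0] and [pi]. *)
Lemma expi_neq1 t : 0 < t < 2 * pi -> expi t != 1.
Proof.
move=> /andP[t0 tpi]; apply/eqP => /(congr1 (@complex.Re R)) /= t1.
have s0 : 0 < sin (t / 2).
  apply: sin_gt0_pi; rewrite divr_gt0 //= ltr_pdivrMr // mulrC //.
have := cos_mulr2n (t / 2); rewrite -[_ / _ *+ 2]mulr_natr divfK // t1 => /eqP.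
rewrite eq_sym subr_eq -mulr2n eqrMn2r // => /eqP c1.
have /eqP := cos2Dsin2 (t / 2); rewrite c1 addrC -subr_eq0 addrK sqrf_eq0.
by rewrite gt_eqF.
Qed.

Lemma expi_primitive_root n : n.+1.-primitive_root (expi (2 * pi / n.+1%:R : R)).
Proof.
have n0 : n.+1%:R != 0 :> R by rewrite pnatr_eq0.
have w1 : expi (2 * pi / n.+1%:R : R) ^+ n.+1 = 1.
  by rewrite expiX divfK // mulr_natl /expi cos2pi sin2pi.
have [m mP /(dvdn_leq (ltn0Sn n))] := prim_order_exists (ltn0Sn n) w1.
rewrite leq_eqVlt => /orP[/eqP mn|mn]; first by rewrite mn in mP.
have m0 := prim_order_gt0 mP.
have tpi : 0 < 2 * pi :> R by rewrite mulr_gt0 // pi_gt0.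
have t0 : 0 < (2 * pi / n.+1%:R * m%:R : R) < 2 * pi.
  rewrite mulrAC -mulrA; apply/andP; split.
    by rewrite mulr_gt0 // divr_gt0 // ltr0n.
  by rewrite gtr_pMr // ltr_pdivrMr ?ltr0n // mul1r ltr_nat.
by have /eqP := prim_expr_order mP; rewrite expiX (negPf (expi_neq1 t0)).
Qed.
End RootOfUnity.

Section Fourier.
Variables (R : realType) (n : nat).
Local Notation C := (R[i]).
Local Notation F := (fourier_matrix R n.+1).
Local Notation w := (expi (2 * pi / n.+1%:R : R)).

(** The scalar product of two rows is the sum of the powers of an [N]-th root of
    unity other than [1], a geometric sum that vanishes. *)
Lemma fourier_hadamard : hadamard F.
Proof.
have F1 i j : `|F i j| = 1 by rewrite mxE normrX norm_expi expr1n.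
split=> // i j ij.
have wP := expi_primitive_root R n.
have w0 m : w ^+ m != 0.
  by rewrite expf_neq0 // -normr_eq0 norm_expi oner_eq0.
pose z := w ^+ i.+1 / w ^+ j.+1.
have z1 : z - 1 != 0.
  rewrite subr_eq0; apply: contra ij => /eqP z1.
  have /eqP : w ^+ i.+1 = w ^+ j.+1 by
    rewrite -[LHS](divfK (w0 j.+1)) -/z z1 mul1r.
  by rewrite (eq_prim_root_expr wP) -addn1 -(addn1 j) eqn_modDr !modn_small.
have zN : z ^+ n.+1 = 1.
  by rewrite expr_div_n -!exprM ![(_ * n.+1)%N]mulnC !exprM (prim_expr_order wP)
             !expr1n divr1.
apply: (mulfI z1); rewrite mulr0.
rewrite (eq_bigr (fun k : 'I__ => z * z ^+ k)) => [|k _].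
  by rewrite -mulr_sumr mulrCA -subrX1 zN subrr mulr0.
have FV : (F j k)^* = (F j k)^-1 by rewrite invC_norm F1 expr1n invr1 mul1r.
by rewrite FV !mxE !exprM -expr_div_n -exprS.
Qed.

Local Notation G := (Zn n.+1).
Local Notation c := (cycle_perm n.+1).

(** The inverse of the cycle is [j |-> j + 1], whose powers reach every point
    from [0]. *)
Lemma Zn_transitive (i j : 'I_n.+1) : exists2 s : 'S_n.+1, s \in G & s j = i.
Proof.
suff ex0 k : exists2 s : 'S_n.+1, s \in G & s ord0 = k.
  have [[s sG <-] [t tG <-]] := (ex0 i, ex0 j).
  by exists (t^-1 * s)%g; rewrite ?groupM ?groupV // permM permK.
case: k; elim=> [|k IH] kn; first by exists 1%g; rewrite ?group1 ?perm1 //;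
  apply: val_inj.
have [s sG sk] := IH (ltnW kn); exists (s * c^-1)%g.
  by rewrite groupM // groupV cycle_id.
rewrite permM sk; apply: (canLR (permK c)); apply: val_inj.
by rewrite /cycle_perm permE /= modnDr modn_small // ltnW.
Qed.

Lemma Zn_comm (s t : 'S_n.+1) j : s \in G -> t \in G -> s (t j) = t (s j).
Proof.
move=> sG tG; rewrite -!permM.
by rewrite (centsP (cycle_abelian c) s sG t tG).
Qed.

(** A transitive abelian group acts freely. *)
Lemma Zn_free (s t : 'S_n.+1) j : s \in G -> t \in G -> s j = t j -> s = t.
Proof.
move=> sG tG st; apply/permP => k; have [a aG <-] := Zn_transitive k j.
by rewrite ![_ (a j)]Zn_comm // st.
Qed.

Lemma fourier_cycle j k : F (c j) k = F j k / w ^+ k.+1.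
Proof.
have wk0 : w ^+ k.+1 != 0.
  by rewrite expf_neq0 // -normr_eq0 norm_expi oner_eq0.
apply: (canRL (mulfK wk0)); rewrite !mxE !(mulnC _ k.+1) !exprM -exprSr.
have z1 : (w ^+ k.+1) ^+ n.+1 = 1.
  by rewrite -exprM mulnC exprM (prim_expr_order (expi_primitive_root R n))
    expr1n.
have cj : c j = ((j + n) %% n.+1)%N :> nat by rewrite /cycle_perm permE
  /= addnS.
rewrite cj -(addn2 (_ %% _)) exprD expr_mod // -exprD -addnA addn2 -addSnnS
  exprD z1.
by rewrite mulr1.
Qed.

(** The cycle divides every row of [F] by the same vector, hence it leaves the
    quotients of rows unchanged. *)
Lemma fourier_proj_Zn s i j : s \in G ->
  hadamard_proj F (s i) (s j) = hadamard_proj F i j.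
Proof.
case/cycleP => m ->; elim: m i j => [|m IH] i j; first by rewrite expg0 !perm1.
rewrite expgSr !permM -[RHS]IH; congr (line_proj _); apply/colP => k.
rewrite [LHS]mxE [RHS]mxE 2!fourier_cycle invfM invrK mulrACA mulVf ?mulr1 //.
by rewrite expf_neq0 // -normr_eq0 norm_expi oner_eq0.
Qed.
End Fourier.

(** * The smallest quantum permutation algebra of the Fourier matrix *)

Section FourierAlgebra.
Variables (R : realType) (n : nat).
Local Notation C := (R[i]).
Local Notation F := (fourier_matrix R n.+1).
Local Notation G := (Zn n.+1).
Local Notation chiG := (chi R G).
Local Notation M := ('M[C]_n.+1).

Definition Zn_proj (s : subg_of G) : M := hadamard_proj F (sgval s ord0) ord0.

Lemma Zn_eval_bij : bijective (fun s : subg_of G => sgval s ord0 : 'I_n.+1).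
Proof.
have inj : injective (fun s : subg_of G => sgval s ord0 : 'I_n.+1).
  by move=> s t st; apply/val_inj/(Zn_free (subgP s) (subgP t) st).
apply: (inj_card_bij inj); rewrite -(card_codom inj).
apply: subset_leq_card; apply/fintype.subsetP => i _.
have [s sG <-] := Zn_transitive i ord0.
by apply/codomP; exists (subg G s); rewrite subgK.
Qed.

Lemma Zn_proj_partition : partition_of_unity Zn_proj.
Proof.
exact: (partition_of_unity_reindex Zn_eval_bij
  (hadamard_partition (fourier_hadamard R n) ord0)).
Qed.

(** [chi i j] is the indicator function of the only [s] with [s j = i], and
    [P_ij] depends only on this [s]. *)
Lemma pou_fun_chi i j : pou_fun Zn_proj (chiG i j) = hadamard_proj F i j.
Proof.
have [s sG sj] := Zn_transitive i j; have [a aG a0] := Zn_transitive j ord0.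
rewrite /pou_fun (bigD1 (subg G s)) //= big1 => [|t ts]; last first.
  rewrite chiE; case: eqP => [tj|_]; last by rewrite scale0r.
  case/eqP: ts; apply: val_inj; rewrite /= subgK //.
  by apply: (Zn_free (subgP t) sG (j := j)); rewrite tj sj.
rewrite addr0 chiE /Zn_proj subgK // sj eqxx scale1r.
by rewrite -(fourier_proj_Zn R _ _ aG) -Zn_comm // a0 sj.
Qed.

(** Any representation with the same values on the generators factors through
    [C(Z_n)], seen as the diagonal algebra of the projections [P_ij]. *)
Lemma factor_fourier (A : cstarType R) (u : 'M[A]_n.+1) (phi : A -> M) :
  generated_by u -> star_morphism phi ->
  (forall i j, phi (u i j) = hadamard_proj F i j) ->
  exists f : A -> Cfun R (subg_of G),
    [/\ star_morphism f, forall i j, f (u i j) = chiG i j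
      & forall a, pou_fun Zn_proj (f a) = phi a].
Proof.
move=> ugen phiP phiu; have QP := Zn_proj_partition.
have Q0 s : Zn_proj s != 0 by exact/hadamard_proj_neq0/fourier_hadamard.
have phiQ s : exists a, phi a = Zn_proj s.
  by exists (u (sgval s ord0) ord0); rewrite phiu.
have phi_chi i j : exists g, phi (u i j) = pou_fun Zn_proj g.
  by exists (chiG i j); rewrite pou_fun_chi.
have [f fP fE] := factor_pou_fun QP (fun s => @line_proj_minimal R n _)
  (@star_mul_eq0 R n) phiP phiQ ugen phi_chi Q0.
exists f; split=> // i j; apply: (pou_fun_inj QP Q0).
by rewrite fE phiu pou_fun_chi.
Qed.

(** Both halves of the universal property are instances of [factor_fourier], for
    [A(S_n)] and for the competing quantum permutation algebra. *)
Lemma chi_is_Api (ASn : cstarType R) (x : 'M[ASn]_n.+1) (pi : ASn -> M) :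
  generated_by x -> star_morphism pi ->
  (forall i j, pi (x i j) = hadamard_proj F i j) -> is_Api x pi chiG.
Proof.
move=> xgen piP pix; split; first exact: chi_quantum_permutation_algebra.
  have [p [pP px pE]] := factor_fourier xgen piP pix.
  exists p, (pou_fun Zn_proj); split=> //.
  exact: pou_fun_star_morphism Zn_proj_partition.
move=> A u [_ ugen _ _ _] [p [q [pP qP px qE]]].
have [i j|f [fP fu _]] := factor_fourier ugen qP.
  by rewrite -px qE pix.
exists f; split=> //.
apply: (@star_subalgebra_chi R n.+1 G) => [|i j]; last first.
  by exists (u i j); rewrite ?fu.
split.
- by exists 1; rewrite ?(star_morph1 fP).
- by move=> c _ _ [a _ <-] [b _ <-]; exists (c *: a + b); rewrite
    ?(star_morphD fP) ?(star_morphZ fP).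
- by move=> _ _ [a _ <-] [b _ <-]; exists (a * b); rewrite ?(star_morphM fP).
- by move=> _ [a _ <-]; exists (star a); rewrite ?(star_morph_star fP).
Qed.
End FourierAlgebra.

(** [f \o g] fixes the entries of [chi], which generate [C(G)]. *)
Lemma chi_left_inverse (R : realType) (n : nat) (G : {group 'S_n})
    (A : cstarType R) (u : 'M[A]_n) (f : A -> Cfun R (subg_of G))
    (g : Cfun R (subg_of G) -> A) :
  star_morphism f -> (forall i j, f (u i j) = chi R G i j) ->
  star_morphism g -> (forall i j, g (chi R G i j) = u i j) -> cancel g f.
Proof.
move=> fP fu gP gchi a.
suff: [set a | f (g a) = a] = setT by move/seteqP => [_ /(_ a I)].
apply: star_subalgebra_chi => [|i j] /=; last by rewrite gchi fu.
split=> /= [|c b d bE dE|b d bE dE|b bE].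
- by rewrite (star_morph1 gP) (star_morph1 fP).
- by rewrite (star_morphD gP) (star_morphD fP) (star_morphZ gP)
    (star_morphZ fP) bE dE.
- by rewrite (star_morphM gP) (star_morphM fP) bE dE.
- by rewrite (star_morph_star gP) (star_morph_star fP) bE.
Qed.

Theorem theorem2p1 (R : realType) (n : nat) (ASn : cstarType R)
    (x : 'M[ASn]_n.+1) (ASnP : is_ASn x) :
  is_Ah x (fourier_matrix R n.+1) (chi R (Zn n.+1)) /\
  (forall (A : cstarType R) (u : 'M[A]_n.+1),
     is_Ah x (fourier_matrix R n.+1) u ->
     qpa_isomorphic u (chi R (Zn n.+1))).
Proof.
have [_ xgen xuniv] := ASnP; split.
  split; first exact: fourier_hadamard.
  have [p pP px] := xuniv _ _ (@chi_magic R n.+1 (Zn n.+1)).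
  have qP := pou_fun_star_morphism (Zn_proj_partition R n).
  have piP := star_morphism_comp pP qP.
  have pix i j : (pou_fun (@Zn_proj R n) \o p) (x i j)
      = hadamard_proj (fourier_matrix R n.+1) i j.
    by rewrite /= px pou_fun_chi.
  by exists (pou_fun (@Zn_proj R n) \o p); split=> //; exact: chi_is_Api.
move=> A u [_ [pi [piP pix [uqpa ufac umin]]]].
have [chiqpa chifac chimin] := chi_is_Api xgen piP pix.
have [g [gP gsurj gchi]] := umin _ _ chiqpa chifac.
have [f [fP _ fu]] := chimin _ _ uqpa ufac.
have gK := chi_left_inverse fP fu gP gchi.
exists f; split=> //; exists g => // a.
by have /seteqP[_ /(_ a I)[b _ <-]] := gsurj; rewrite gK.
Qed.
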